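(* Let $G$ be a finite connected graph without loops on vertices $v_1,\dots,v_n$, let $(\mathbf d,\mathbf r)$ be an arithmetical structure on $G$, and let $(G',\mathbf d',\mathbf r')$ be the result of the Keyes--Reiter operation at $v_n$. Let $\alpha_1\mid\cdots\mid\alpha_{n-1}$ be the positive invariant factors of $L=\operatorname{diag}(\mathbf d)-A$ and $\alpha'_1\mid\cdots\mid\alpha'_{n-2}$ those of $L'=\operatorname{diag}(\mathbf d')-A'$. Then for all $k\in\{2,3,\dotsc,n-2\}$: (a) $\alpha'_k$ divides $(g_n(L))^2d_n\alpha_{k+1}$; (b) $d_n\alpha_{k+1}$ divides $(g_n(L))^2\alpha'_k$; (c) $\dfrac{d_n\alpha_{k+1}}{(g_n(L))^2}\le\alpha'_k\le(g_n(L))^2d_n\alpha_{k+1}$.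
   Context: $G$ is a finite connected graph without loops (multiple edges allowed), adjacency matrix $A$ with entries $\delta_{i,j}$. An arithmetical structure is $(\mathbf d,\mathbf r)\in\mathbb Z_{\ge0}^n\times\mathbb Z_{>0}^n$ with $(\operatorname{diag}(\mathbf d)-A)\mathbf r=\mathbf 0$ and gcd of the entries of $\mathbf r$ equal to $1$. The Keyes--Reiter operation at $v_n$ produces $G'$ on $v_1,\dots,v_{n-1}$ with $\delta'_{i,j}=\delta_{i,j}d_n+\delta_{i,n}\delta_{n,j}$ edges between $v_i,v_j$ ($i\ne j$), no loops, adjacency matrix $A'$, and $d'_i=d_id_n-\delta_{i,n}\delta_{n,i}$, $r'_i=r_i/\gcd_{j\in[n-1]}r_j$. $L$ has rank $n-1$ and $L'$ rank $n-2$; the invariant factors are $\alpha_k=D_k(L)/D_{k-1}(L)$, $\alpha'_k=D_k(L')/D_{k-1}(L')$, where $D_k$ is the gcd of all $k\times k$ minors and $D_0=1$. $g_n(L)$ is the gcd of the entries of row $n$ of $L$. *)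

(* Defs.v *)
From HB Require Import structures.
From mathcomp Require Import all_boot all_order all_algebra.

Set Implicit Arguments.
Unset Strict Implicit.
Unset Printing Implicit Defensive.

Import Order.TTheory GRing.Theory Num.Theory.
Local Open Scope ring_scope.

Record multigraph (n : nat) := Multigraph {
  mult : 'I_n -> 'I_n -> nat;
  mult_sym : forall i j, mult i j = mult j i;
  mult_loopless : forall i, mult i i = 0%N
}.

Definition connected_graph n (G : multigraph n) : Prop :=
  forall i j : 'I_n, connect (fun x y => 0 < mult G x y)%N i j.

Definition adjacency n (G : multigraph n) : 'M[int]_n :=
  \matrix_(i, j) (mult G i j)%:Z.

Definition laplacian n (G : multigraph n) (d : {ffun 'I_n -> int}) : 'M[int]_n :=
  diag_mx (\row_i d i) - adjacency G.

Definition vec_gcd n (r : {ffun 'I_n -> int}) : nat :=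
  \big[gcdn/0%N]_(i < n) `|r i|%N.

Definition arithmetical_structure n (G : multigraph n)
    (d r : {ffun 'I_n -> int}) : Prop :=
  [/\ forall i, 0 <= d i,
      forall i, 0 < r i,
      laplacian G d *m (\col_i r i) = 0
    & vec_gcd r = 1%N].

Section KeyesReiter.
Variable n : nat.
Implicit Types (G : multigraph n.+1) (d r : {ffun 'I_n.+1 -> int}).

(* The vertices v_1, ..., v_{n+1} are 0, ..., n : 'I_n.+1; the operation is
   performed at the last one, ord_max, and 'I_n indexes the others. *)
Definition old (i : 'I_n) : 'I_n.+1 := widen_ord (leqnSn n) i.

(* Taking the absolute value of d ord_max is harmless: the entries of d are
   nonnegative in an arithmetical structure. *)
Definition KR_mult G d (i j : 'I_n) : nat :=
  if i == j then 0%N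
  else (mult G (old i) (old j) * `|d ord_max|
        + mult G (old i) ord_max * mult G ord_max (old j))%N.

Lemma KR_mult_sym G d i j : KR_mult G d i j = KR_mult G d j i.
Proof.
rewrite /KR_mult eq_sym (mult_sym G (old i) (old j)).
by rewrite (mult_sym G (old i) ord_max) (mult_sym G ord_max (old j)) [X in (_ + X)%N]mulnC.
Qed.

Lemma KR_mult_loopless G d i : KR_mult G d i i = 0%N.
Proof. by rewrite /KR_mult eqxx. Qed.

Definition KR_graph G d : multigraph n :=
  Multigraph (KR_mult_sym G d) (KR_mult_loopless G d).

Definition KR_d G d : {ffun 'I_n -> int} :=
  [ffun i => d (old i) * d ord_max
             - (mult G (old i) ord_max)%:Z * (mult G ord_max (old i))%:Z].

(* The division is exact. *)
Definition KR_r r : {ffun 'I_n -> int} :=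
  [ffun i => (r (old i) %/ (vec_gcd [ffun j => r (old j)])%:Z)%Z].

Definition keyes_reiter G d r :
    multigraph n * {ffun 'I_n -> int} * {ffun 'I_n -> int} :=
  (KR_graph G d, KR_d G d, KR_r r).

End KeyesReiter.

Definition increasing k m (f : {ffun 'I_k -> 'I_m}) : bool :=
  [forall i : 'I_k, forall j : 'I_k, (i < j)%N ==> (f i < f j)%N].

(* D_k(M), the gcd of all k x k minors, the rows and columns of a minor being
   selected by strictly increasing maps; D_0(M) = 1 since the empty determinant
   is 1. *)
Definition minors_gcd m n (M : 'M[int]_(m, n)) (k : nat) : nat :=
  \big[gcdn/0%N]_(f : {ffun 'I_k -> 'I_m} | increasing f)
    \big[gcdn/0%N]_(g : {ffun 'I_k -> 'I_n} | increasing g)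
      `|\det (mxsub f g M)|%N.

Lemma minors_gcd0 m n (M : 'M[int]_(m, n)) : minors_gcd M 0 = 1%N.
Proof.
have e p (h : {ffun 'I_0 -> 'I_p}) : increasing h by apply/forallP=> -[].
have u p (h h0 : {ffun 'I_0 -> 'I_p}) : h = h0 by apply/ffunP=> -[].
have E p : exists h : {ffun 'I_0 -> 'I_p}, true.
  by exists (finfun (fun i : 'I_0 => let: Ordinal _ h := i in
                      False_rect 'I_p (notF h))).
have [[f0 _] [g0 _]] := (E m, E n); rewrite /minors_gcd.
rewrite (big_pred1 f0) => [|f]; last by rewrite (u _ f f0) e /= eqxx.
rewrite (big_pred1 g0) => [|g]; last by rewrite (u _ g g0) e /= eqxx.
by rewrite det_mx00.
Qed.

(* The k-th invariant factor, D_k(M) / D_(k-1)(M), for 1 <= k <= rank M, a range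
   in which the division is exact. *)
Definition invariant_factor m n (M : 'M[int]_(m, n)) (k : nat) : nat :=
  (minors_gcd M k %/ minors_gcd M k.-1)%N.

Definition row_gcd m n (M : 'M[int]_(m, n)) (i : 'I_m) : nat :=
  \big[gcdn/0%N]_(j < n) `|M i j|%N.

(* Main.v *)
Require Import Defs.
From mathcomp Require Import all_boot all_order all_algebra all_fingroup.
From mathcomp Require Import ring.

Set Implicit Arguments.
Unset Strict Implicit.
Unset Printing Implicit Defensive.

Import Order.TTheory GRing.Theory Num.Theory.
Local Open Scope ring_scope.

(* The entries of [L'] are the 2 x 2 minors of [L] through the pivot
   [d_n = L n n], so by Chio condensation a k-minor of [L'] is [d_n ^ (k - 1)]
   times a (k+1)-minor of [L] through the pivot, and
   [D_k(L') = d_n ^ (k - 1) * e_k] with [e_k] the gcd of these minors of [L].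
   The heart of the proof is that [D_(k+1)(L)] divides [e_k], which divides
   [g_n(L) ^ 2 * D_(k+1)(L)]: Laplace expansions of a bordered minor modulo [e_k]
   show that one factor [g_n(L)] pays for moving a row of the minor to row n, and
   another one for moving a column to column n. Taking quotients of consecutive
   values of k gives [b * alpha'_k = a * d_n * alpha_(k+1)] with [a] and [b]
   dividing [g_n(L) ^ 2]. *)

(** * Cofactor expansion and Chio condensation *)

Lemma sum_col_cofactor (R : comPzRingType) n (A : 'M[R]_n) j j' :
  \sum_i A i j' * cofactor A i j = \det A *+ (j == j').
Proof.
have /matrixP/(_ j j') := mul_adj_mx A; rewrite !mxE => <-.
by apply: eq_bigr => i _; rewrite mxE mulrC.
Qed.

(** Left multiplication by a block lower triangular matrix with diagonal blocks [1] and the scalar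
    pivot clears the first column below the pivot. A factor of the pivot stays on both sides, which
    keeps the identity free of division. *)
Lemma chio_condensation (R : comPzRingType) k (M : 'M[R]_k.+1) :
  M ord0 ord0 ^+ k * \det M =
  M ord0 ord0 * \det (\matrix_(i < k, j < k)
    (M ord0 ord0 * M (lift ord0 i) (lift ord0 j) - M (lift ord0 i) ord0 * M ord0 (lift ord0 j))).
Proof.
pose x : 'M_(k, 1) := \col_i M (lift ord0 i) ord0.
pose y : 'M_(1, k) := \row_j M ord0 (lift ord0 j).
pose B : 'M_k := \matrix_(i, j) M (lift ord0 i) (lift ord0 j).
pose M1 := block_mx (M ord0 ord0)%:M y x B.
have M_M1 : M = M1 :> 'M_(1 + k).
  apply/matrixP => i j; rewrite -(splitK i) -(splitK j) /M1.
  case: (split i) => i'; case: (split j) => j' /=;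
    rewrite ?(block_mxEul, block_mxEur, block_mxEdl, block_mxEdr) ?mxE
      ?lshift0 ?rshift1 ?(ord1 i') ?(ord1 j') ?eqxx ?mulr1n; congr (M _ _);
    by apply: val_inj.
have /(congr1 determinant) : block_mx 1%:M 0 (- x) (M ord0 ord0)%:M *m M1 =
    block_mx (M ord0 ord0)%:M y 0 (M ord0 ord0 *: B - x *m y).
  rewrite /M1 mulmx_block !mul1mx !mul0mx !addr0; congr block_mx.
    by rewrite mul_mx_scalar mul_scalar_mx scalerN addNr.
  by rewrite mulNmx mul_scalar_mx addrC.
rewrite det_mulmx det_lblock det_ublock !det_scalar expr1n mul1r expr1 -M_M1 => ->.
congr (_ * \det _); apply/matrixP => i j.
by rewrite !mxE big_ord1 !mxE.
Qed.

(** * Minors selected by arbitrary maps *)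

Lemma det_mxsub_perm (R : comPzRingType) m n k (A : 'M[R]_(m, n))
    (f : 'I_k -> 'I_m) (h : 'I_k -> 'I_n) (s t : 'S_k) :
  \det (mxsub (f \o s) (h \o t) A) = (-1) ^+ s * (-1) ^+ t * \det (mxsub f h A).
Proof.
rewrite mxsub_comp mxsubrc -row_permEsub -col_permEsub row_permE col_permE.
by rewrite !det_mulmx !det_perm odd_permV mulrA [RHS]mulrAC.
Qed.

Lemma det_mxsub_notinj (R : comPzRingType) m n k (A : 'M[R]_(m, n))
    (f : 'I_k -> 'I_m) (h : 'I_k -> 'I_n) :
  ~~ injectiveb f || ~~ injectiveb h -> \det (mxsub f h A) = 0.
Proof.
have rows m' n' (C : 'M[R]_(m', n')) (u : 'I_k -> 'I_m') (v : 'I_k -> 'I_n') :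
  ~~ injectiveb u -> \det (mxsub u v C) = 0.
  case/injectivePn => i [j ij uij]; apply: (determinant_alternate ij) => l.
  by rewrite !mxE uij.
by case/orP => [/rows -> // | /rows E]; rewrite -det_tr trmx_mxsub E.
Qed.

(** [minors_gcd] ranges over increasing selections; sorting an arbitrary injective selection only
    costs a sign. *)
Lemma increasing_reorder k m (f : 'I_k -> 'I_m) : injective f ->
  exists s : 'S_k, increasing [ffun i => f (s i)].
Proof.
move=> f_inj; pose A := f @: setT.
have cA : k = #|A| by rewrite card_imset // cardsT card_ord.
have preim i : exists j, f j = enum_val (cast_ord cA i).
  have /imsetP[j _ ->] := enum_valP (cast_ord cA i).
  by exists j.
have [s fs] := fin_all_exists preim.
have s_inj : injective s.
  by move=> i j /(congr1 f); rewrite !fs => /enum_val_inj/cast_ord_inj.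
exists (perm s_inj); apply/forallP => i; apply/forallP => j; apply/implyP => ij.
rewrite !ffunE !permE !fs !(enum_val_nth (f i)) /=.
(* [enum A] filters the increasing enumeration of ['I_m], hence is sorted for [r]. *)
pose r := relpre (val : 'I_m -> nat) ltn.
have r_tr : transitive r by move=> ? ? ?; apply: ltn_trans.
apply: (sorted_ltn_nth r_tr) => //; rewrite ?inE -?cardE -?cA //.
rewrite /enum_mem; apply: sorted_filter => //.
by rewrite -enumT -sorted_map val_enum_ord iota_ltn_sorted.
Qed.

Lemma minors_gcd_dvd m n (M : 'M[int]_(m, n)) k
    (f : 'I_k -> 'I_m) (h : 'I_k -> 'I_n) :
  ((minors_gcd M k)%:Z %| \det (mxsub f h M))%Z.
Proof.
have [] := boolP (~~ injectiveb f || ~~ injectiveb h).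
  by move/det_mxsub_notinj->; apply: dvdz0.
rewrite negb_or !negbK => /andP[/injectiveP f_inj /injectiveP h_inj].
have [s fs] := increasing_reorder f_inj; have [t ht] := increasing_reorder h_inj.
rewrite dvdzE absz_nat; have -> : `|\det (mxsub f h M)|%N =
    `|\det (mxsub [ffun i => f (s i)] [ffun i => h (t i)] M)|%N.
  by rewrite mxsub_ffun (det_mxsub_perm M f h s t) -signr_addb abszMsign.
by apply: (biggcdn_inf _ fs); apply: (biggcdn_inf _ ht).
Qed.

(** A common factor passes through a gcd; [c] will be the square of the row gcd. *)
Lemma dvd_mul_minors_gcd m n (M : 'M[int]_(m, n)) k (c e : int) :
  (forall (f : 'I_k -> 'I_m) (h : 'I_k -> 'I_n),
     (e %| c * \det (mxsub f h M))%Z) ->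
  (e %| c * (minors_gcd M k)%:Z)%Z.
Proof.
move=> eM; rewrite dvdzE abszM absz_nat big_distrr /=.
apply/dvdn_biggcdP => f _; rewrite big_distrr /=.
by apply/dvdn_biggcdP => h _; have := eM f h; rewrite dvdzE abszM.
Qed.

Lemma dvd_minors_gcd m n (M : 'M[int]_(m, n)) k (e : int) :
  (forall (f : 'I_k -> 'I_m) (h : 'I_k -> 'I_n), (e %| \det (mxsub f h M))%Z) ->
  (e %| (minors_gcd M k)%:Z)%Z.
Proof.
by move=> eM; rewrite -[_%:Z]mul1r dvd_mul_minors_gcd // => f h; rewrite mul1r.
Qed.

Lemma cofactor_mxsub (R : comPzRingType) m n k (A : 'M[R]_(m, n))
    (f : 'I_k.+1 -> 'I_m) (h : 'I_k.+1 -> 'I_n) i j :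
  cofactor (mxsub f h A) i j =
  (-1) ^+ (i + j) * \det (mxsub (f \o lift i) (h \o lift j) A).
Proof.
by congr (_ * \det _); apply/matrixP => a b; rewrite !mxE.
Qed.

Lemma minors_gcd_dvdS m n (M : 'M[int]_(m, n)) k :
  (minors_gcd M k %| minors_gcd M k.+1)%N.
Proof.
suff: ((minors_gcd M k)%:Z %| (minors_gcd M k.+1)%:Z)%Z by rewrite dvdzE.
apply: dvd_minors_gcd => f h; rewrite (expand_det_row _ 0).
apply: rpred_sum => i _; rewrite cofactor_mxsub mulrA.
exact/dvdz_mull/minors_gcd_dvd.
Qed.

(** * Row gcds and bordered minors *)

Lemma dvdz_row_gcd m n (M : 'M[int]_(m, n)) i (e c : int) :
  (forall j, (e %| M i j * c)%Z) -> (e %| (row_gcd M i)%:Z * c)%Z.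
Proof.
move=> eM; rewrite dvdzE abszM absz_nat /row_gcd big_distrl /=.
by apply/dvdn_biggcdP => j _; have := eM j; rewrite dvdzE abszM.
Qed.

(* With [h = gcdz x1 x2 = u x1 + v x2], [x1 = s h] and [x2 = t h], modulo [e]
   both [s u D] and [t v D] are congruent to [D], while [s u + t v = 1]. *)
Lemma dvdz_bezout_exchange (e x1 x2 c1 c2 D : int) :
  (e %| x1 * c1 - D)%Z -> (e %| x2 * c2 - D)%Z ->
  (e %| x2 * c1)%Z -> (e %| x1 * c2)%Z -> (e %| D)%Z.
Proof.
have [u [v uv]] := Bezoutz x1 x2; set h := gcdz x1 x2 in uv.
have /dvdzP[s s_h] : (h %| x1)%Z by apply: dvdz_gcdl.
have /dvdzP[t t_h] : (h %| x2)%Z by apply: dvdz_gcdr.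
move=> e1 e2 e21 e12; have [h0|h0] := eqVneq h 0.
  by move: e1; rewrite s_h h0 mulr0 mul0r sub0r rpredN.
have st1 : s * u + t * v = 1.
  by apply: (mulIf h0); rewrite mul1r -{2}uv s_h t_h; ring.
have -> : D = (1 - s * u) * - (x1 * c1 - D) + (1 - t * v) * - (x2 * c2 - D)
              + s * v * (x2 * c1) + t * u * (x1 * c2).
  have -> : s * v * (x2 * c1) = t * v * (x1 * c1) by rewrite s_h t_h; ring.
  have -> : t * u * (x1 * c2) = s * u * (x2 * c2) by rewrite s_h t_h; ring.
  have -> : t * v = 1 - s * u by rewrite -st1; ring.
  ring.
by rewrite !rpredD // dvdz_mull // rpredN.
Qed.

(* [M] is a bordered minor, [(i0, j0)] the position of the pivot, and the
   hypothesis concerns the maximal proper minors of [M] through the pivot. *)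
Section MinorsThroughPivot.
Variables (e : int) (k : nat) (M : 'M[int]_k) (i0 j0 : 'I_k).
Hypothesis eM : forall i j, i != i0 -> j != j0 -> (e %| cofactor M i j)%Z.

(** Pair column [j'] with the cofactors of column [j]: modulo [e] only the term of row [i0]
    survives. *)
Lemma dvdz_pivot_row j j' : j != j0 ->
  (e %| M i0 j' * cofactor M i0 j - \det M *+ (j == j'))%Z.
Proof.
move=> jj0; rewrite -sum_col_cofactor (bigD1 i0) //= opprD addNKr rpredN.
by apply: rpred_sum => i ii0; apply/dvdz_mull/eM.
Qed.

(** Size at least 3 leaves two columns [j1], [j2] besides that of the pivot; the four congruences
    between them feed the Bezout exchange. *)
Lemma dvdz_det_through_pivot : (2 < k)%N -> (e %| \det M)%Z.
Proof.
move=> k2; have [j1 [j2 [j10 j20 j12]]] :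
    exists j1 j2, [/\ j1 != j0, j2 != j0 & j1 != j2].
  have : (1 < #|[set~ j0]|)%N.
    by rewrite cardsC1 card_ord -ltnS prednK // ltnW // ltnW.
  by case/card_gt1P => j1 [j2]; rewrite !inE => -[? ? ?]; exists j1, j2.
have piv := dvdz_pivot_row.
apply: (@dvdz_bezout_exchange e (M i0 j1) (M i0 j2)
          (cofactor M i0 j1) (cofactor M i0 j2)).
- by move: (piv j1 j1 j10); rewrite eqxx.
- by move: (piv j2 j2 j20); rewrite eqxx.
- by move: (piv j1 j2 j10); rewrite (negPf j12) subr0.
- by move: (piv j2 j1 j20); rewrite eq_sym (negPf j12) subr0.
Qed.

Lemma dvdz_pivot_row_cofactor j j' : (2 < k)%N -> j != j0 ->
  (e %| M i0 j' * cofactor M i0 j)%Z.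
Proof.
move=> k2 jj0; rewrite -[M i0 j' * _](subrK (\det M *+ (j == j'))).
by rewrite rpredD ?dvdz_pivot_row // rpredMn // dvdz_det_through_pivot.
Qed.

End MinorsThroughPivot.

(** Borders a minor: [x] is the new row or column, put in position 0. *)
Definition fcons (T : Type) k (x : T) (f : 'I_k -> T) (i : 'I_k.+1) : T :=
  oapp f x (unlift ord0 i).

Lemma fcons0 (T : Type) k (x : T) (f : 'I_k -> T) : fcons x f ord0 = x.
Proof. by rewrite /fcons unlift_none. Qed.

Lemma fconsS (T : Type) k (x : T) (f : 'I_k -> T) i : fcons x f (lift ord0 i) = f i.
Proof. by rewrite /fcons liftK. Qed.

Lemma lift_codom (T : eqType) k (F : 'I_k.+1 -> T) i j x :
  i != j -> F j = x -> x \in codom (F \o lift i).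
Proof.
by case/unlift_some => l -> _ <-; apply/codomP; exists l.
Qed.

Lemma cofactor00_mxsub_fcons (R : comPzRingType) m n k (A : 'M[R]_(m, n))
    (f : 'I_k -> 'I_m) (h : 'I_k -> 'I_n) a b :
  cofactor (mxsub (fcons a f) (fcons b h) A) 0 0 = \det (mxsub f h A).
Proof.
rewrite cofactor_mxsub mul1r; congr (\det _); apply/matrixP => i j.
by rewrite !mxE /= !fconsS.
Qed.

Section MinorsThroughEntry.
Variables (N : nat) (L : 'M[int]_N) (q : 'I_N).

Lemma dvdz_minor_col (e : int) k b (f h : 'I_k.+2 -> 'I_N) :
  (forall f h : 'I_k.+2 -> 'I_N, q \in codom f -> q \in codom h ->
     (e %| \det (mxsub f h L))%Z) ->
  q \in codom h -> (e %| L q b * \det (mxsub f h L))%Z.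
Proof.
move=> eL /codomP[l hl]; pose M := mxsub (fcons q f) (fcons b h) L.
rewrite -(cofactor00_mxsub_fcons _ f h q b).
have -> : L q b = M 0 0 by rewrite !mxE !fcons0.
(* The pivot of [M] is the entry ([q], [q]) of [L]: row 0 and column [lift ord0 l] both come from
   [q]. *)
apply: (@dvdz_pivot_row_cofactor _ _ _ 0 (lift ord0 l)) => // i j i0 j0.
rewrite cofactor_mxsub dvdz_mull //; apply: eL.
  by apply: (lift_codom i0); rewrite fcons0.
by apply: (lift_codom j0); rewrite fconsS.
Qed.

(** Border by row [q] and column [b]. Expanding along another row gives [e] dividing [c * \det M];
    expanding along column 0 then isolates the corner term. *)
Lemma dvdz_minor_row (e c : int) k b (f h : 'I_k.+1 -> 'I_N) :
  (forall f h : 'I_k.+1 -> 'I_N, q \in codom f ->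
     (e %| c * \det (mxsub f h L))%Z) ->
  (e %| L q b * (c * \det (mxsub f h L)))%Z.
Proof.
move=> eL; pose M := mxsub (fcons q f) (fcons b h) L.
have eC i j : i != 0 -> (e %| c * cofactor M i j)%Z.
  move=> i0; rewrite cofactor_mxsub mulrCA dvdz_mull //; apply: eL.
  by apply: (lift_codom i0); rewrite fcons0.
rewrite -(cofactor00_mxsub_fcons _ f h q b).
have -> : L q b = M 0 0 by rewrite !mxE !fcons0.
have : (e %| c * \det M)%Z.
  rewrite (expand_det_row _ (lift ord0 0)) mulr_sumr; apply: rpred_sum => j _.
  by rewrite mulrCA dvdz_mull // eC.
rewrite (expand_det_col _ 0) (bigD1 0) //= mulrDr mulrCA rpredDr //.
rewrite mulr_sumr; apply: rpred_sum => i i0.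
by rewrite mulrCA dvdz_mull // eC.
Qed.

(** One factor brings [q] among the rows; transposition, by symmetry of [L], reduces the other
    factor to the case of columns. *)
Lemma dvdz_row_gcd_sqr_minor (e : int) k (f h : 'I_k.+2 -> 'I_N) :
  L^T = L ->
  (forall f h : 'I_k.+2 -> 'I_N, q \in codom f -> q \in codom h ->
     (e %| \det (mxsub f h L))%Z) ->
  (e %| (row_gcd L q)%:Z ^+ 2 * \det (mxsub f h L))%Z.
Proof.
move=> symL eL; rewrite expr2 -mulrA; apply: dvdz_row_gcd => b.
apply: dvdz_minor_row => {}f {}h qf; apply: dvdz_row_gcd => a.
rewrite -det_tr trmx_mxsub symL; exact: dvdz_minor_col.
Qed.

End MinorsThroughEntry.

(** * Laplacians of arithmetical structures *)

Lemma tr_laplacian n (G : multigraph n) d : (laplacian G d)^T = laplacian G d.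
Proof.
apply/matrixP => i j; rewrite !mxE (mult_sym G) eq_sym.
by case: eqVneq => // ->.
Qed.

(** If [d i = 0], row [i] of the kernel equation is a vanishing sum of nonnegative terms, so [i] is
    isolated. *)
Lemma arithmetical_structure_gt0 n (G : multigraph n) d r : (1 < n)%N ->
  connected_graph G -> arithmetical_structure G d r -> forall i, 0 < d i.
Proof.
move=> n_gt1 Gconn [d_ge0 r_gt0 Lr0 _] i; rewrite lt_neqAle d_ge0 andbT eq_sym.
apply/eqP => di0; have [j ij] : exists j, j != i.
  have : (0 < #|[set~ i]|)%N by rewrite cardsC1 card_ord -ltnS prednK // ltnW.
  by case/card_gt0P => j; rewrite !inE; exists j.
have no_edge l : mult G i l = 0%N.
  have /matrixP/(_ i 0) := Lr0; rewrite !mxE => /eqP.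
  rewrite -oppr_eq0 -sumrN psumr_eq0 => [/allP/(_ l (mem_index_enum _))|l' _].
    rewrite !mxE di0 mul0rn sub0r mulNr opprK /= mulf_eq0.
    by rewrite (gt_eqF (r_gt0 l)) orbF => /eqP[].
  by rewrite !mxE di0 mul0rn sub0r mulNr opprK mulr_ge0 // ltW.
have /connectP[[|l p] /=] := Gconn i j.
  by move=> _ /eqP; rewrite (negPf ij).
by rewrite no_edge ltnn.
Qed.

(** * Minors of the Laplacian after the operation *)

Section KeyesReiterMinors.
Variables (n : nat) (G : multigraph n.+1) (d : {ffun 'I_n.+1 -> int}).
Hypothesis dn_gt0 : 0 < d ord_max.

Let L := laplacian G d.
Let L' := laplacian (KR_graph G d) (KR_d G d).
Let dn : int := d ord_max.

Lemma laplacian_pivot : L ord_max ord_max = dn.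
Proof. by rewrite !mxE eqxx mult_loopless subr0. Qed.

Lemma KR_laplacianE i j :
  L' i j = dn * L (old i) (old j) - L (old i) ord_max * L ord_max (old j).
Proof.
have old_max l : (old l == ord_max) = false.
  by apply/eqP => /(congr1 val) /= E; have := ltn_ord l; rewrite E ltnn.
rewrite !mxE old_max [ord_max == _]eq_sym old_max !mulr0n !sub0r mulrNN.
rewrite ffunE -(inj_eq val_inj (old i)) /= (inj_eq val_inj) /KR_mult.
have [->|ij] := eqVneq i j; first by rewrite mult_loopless !subr0 mulrC.
rewrite !mulr0n !sub0r PoszD !PoszM gez0_abs ?ltW // /dn; ring.
Qed.

Lemma KR_minor k (f h : 'I_k.+1 -> 'I_n) :
  \det (mxsub f h L') = dn ^+ k *
    \det (mxsub (fcons ord_max (@old n \o f)) (fcons ord_max (@old n \o h)) L).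
Proof.
have dn0 : dn != 0 by rewrite gt_eqF.
apply: (mulfI dn0); rewrite mulrA -exprS.
set M := mxsub _ _ L; have M00 : M ord0 ord0 = dn.
  by rewrite mxE !fcons0 laplacian_pivot.
rewrite -{2}M00 chio_condensation M00; congr (_ * \det _).
apply/matrixP => i j; rewrite [RHS]mxE [LHS]mxE KR_laplacianE.
by rewrite ![M _ _]mxE !fcons0 !fconsS.
Qed.

(** Transposing [ord_max] to the front gives a minor through the pivot the bordered shape of
    [KR_minor]. *)
Lemma codom_ord_max_reorder k (f : 'I_k.+1 -> 'I_n.+1) :
  injective f -> ord_max \in codom f ->
  exists (s : 'S_k.+1) (f1 : 'I_k -> 'I_n), f \o s =1 fcons ord_max (@old n \o f1).
Proof.
move=> f_inj /codomP[i0 fi0]; pose s := tperm ord0 i0; exists s.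
have preim i : exists j, f (s (lift ord0 i)) = old j.
  have [/eqP E|] := eqVneq (f (s (lift ord0 i))) ord_max.
    have := neq_lift ord0 i; rewrite -(inj_eq (@perm_inj _ s)) tpermL eq_sym.
    by rewrite -(inj_eq f_inj) -fi0 E.
  rewrite eq_sym => /unlift_some[j -> _]; exists j.
  by apply: val_inj; apply: lift_max.
have [f1 f1E] := fin_all_exists preim; exists f1 => i /=.
case: (unliftP ord0 i) => [j|] ->; first by rewrite fconsS f1E.
by rewrite fcons0 tpermL -fi0.
Qed.

Lemma KR_minors_gcd_dvd k (f h : 'I_k.+2 -> 'I_n.+1) :
  ord_max \in codom f -> ord_max \in codom h ->
  ((minors_gcd L' k.+1)%:Z %| dn ^+ k * \det (mxsub f h L))%Z.
Proof.
move=> fmax hmax; have [] := boolP (~~ injectiveb f || ~~ injectiveb h).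
  by move/det_mxsub_notinj->; rewrite mulr0 dvdz0.
rewrite negb_or !negbK => /andP[/injectiveP f_inj /injectiveP h_inj].
have [s [f1 sf]] := codom_ord_max_reorder f_inj fmax.
have [t [h1 th]] := codom_ord_max_reorder h_inj hmax.
have := minors_gcd_dvd L' f1 h1; rewrite KR_minor -(eq_mxsub _ _ sf th) det_mxsub_perm.
by rewrite -signr_addb mulrCA dvdzE abszMsign -dvdzE.
Qed.

(** [e] is obtained as the exact quotient of [minors_gcd L' k.+1] by [dn ^+ k]. *)
Lemma KR_minors_gcd k : exists e : nat,
  [/\ minors_gcd L' k.+1 = (`|dn| ^ k * e)%N,
      (minors_gcd L k.+2 %| e)%N &
      (e %| row_gcd L ord_max ^ 2 * minors_gcd L k.+2)%N].
Proof.
have dnk_gt0 : 0 < dn ^+ k by rewrite exprn_gt0.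
have dnk0 : dn ^+ k != 0 by rewrite gt_eqF.
have /dvdzP[e0 De0] : (dn ^+ k %| (minors_gcd L' k.+1)%:Z)%Z.
  by apply: dvd_minors_gcd => f h; rewrite KR_minor dvdz_mulr.
have De : (minors_gcd L' k.+1)%:Z = dn ^+ k * (`|e0|%N)%:Z.
  have e0_ge0 : 0 <= e0 by rewrite -(pmulr_lge0 _ dnk_gt0) -De0.
  by rewrite De0 gez0_abs // mulrC.
exists `|e0|%N; split.
- by apply/eqP; rewrite -eqz_nat PoszM -abszX gez0_abs ?De // exprn_ge0 // ltW.
- have : (dn ^+ k * (minors_gcd L k.+2)%:Z %| dn ^+ k * (`|e0|%N)%:Z)%Z.
    rewrite -De; apply: dvd_minors_gcd => f h.
    by rewrite KR_minor dvdz_mul // minors_gcd_dvd.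
  by rewrite dvdz_mul2l.
- suff: ((`|e0|%N)%:Z %| (row_gcd L ord_max)%:Z ^+ 2 * (minors_gcd L k.+2)%:Z)%Z.
    by rewrite dvdzE abszM abszX.
  apply: dvd_mul_minors_gcd => f h; apply: dvdz_row_gcd_sqr_minor.
    exact: tr_laplacian.
  move=> {}f {}h fmax hmax; rewrite -(dvdz_mul2l dnk0) -De.
  exact: KR_minors_gcd_dvd.
Qed.

End KeyesReiterMinors.

(** * Comparison of invariant factors *)

(** [P] and [Q] stand for consecutive minor gcds of [L], [c * dn * A] and [c * B] for those of [L'].
    The witnesses are [A / P] and [B / Q]. *)
Lemma ratio_comparison (dn c g P Q A B : nat) : (0 < c)%N ->
  (Q %| P)%N -> (c * B %| c * dn * A)%N ->
  (P %| A)%N -> (A %| g * P)%N -> (Q %| B)%N -> (B %| g * Q)%N ->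
  exists a b, [/\ (a %| g)%N, (b %| g)%N &
    (b * (c * dn * A %/ (c * B)) = dn * a * (P %/ Q))%N].
Proof.
move=> c_gt0 QP cBA PA AP QB BQ.
(* If [Q] or [P] is 0, so is [B] or [A]; both quotients are then 0, as division by 0 yields 0. *)
have [Q0|Q_gt0] := posnP Q.
  exists 1%N, 1%N; move: QB; rewrite !dvd1n Q0 dvd0n => /eqP->.
  by rewrite muln0 !divn0 !muln0.
have [P0|P_gt0] := posnP P.
  exists 1%N, 1%N; move: PA; rewrite !dvd1n P0 dvd0n => /eqP->.
  by rewrite muln0 !div0n !muln0.
case/dvdnP: PA AP cBA => a ->; rewrite dvdn_pmul2r // => ag.
case/dvdnP: QB BQ => b ->; rewrite dvdn_pmul2r // => bg cBA.
exists a, b; split=> //.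
apply/eqP; rewrite -(eqn_pmul2r Q_gt0) -(eqn_pmul2l c_gt0); apply/eqP.
transitivity (c * dn * (a * P))%N; last by rewrite -{1}(divnK QP); ring.
by rewrite -{2}(divnK cBA); ring.
Qed.

Theorem theorem4p6 (n : nat) (G : multigraph n.+1) (d r : {ffun 'I_n.+1 -> int})
    (Gconn : connected_graph G) (Gdr : arithmetical_structure G d r)
    (G' : multigraph n) (d' r' : {ffun 'I_n -> int})
    (KR : (G', d', r') = keyes_reiter G d r)
    (k : nat) (hk : (2 <= k <= n.+1 - 2)%N) :
  let L := laplacian G d in
  let L' := laplacian G' d' in
  let dn := d ord_max in
  let g := (row_gcd L ord_max)%:Z in
  let alpha := fun i => (invariant_factor L i)%:Z in
  let alpha' := fun i => (invariant_factor L' i)%:Z in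
  [/\ (alpha' k %| g ^+ 2 * dn * alpha k.+1)%Z,
      (dn * alpha k.+1 %| g ^+ 2 * alpha' k)%Z
    & (dn * alpha k.+1)%:~R / (g ^+ 2)%:~R <= (alpha' k)%:~R :> rat /\
      (alpha' k)%:~R <= (g ^+ 2 * dn * alpha k.+1)%:~R :> rat].
Proof.
case: KR => -> -> _ L L' dn g alpha alpha'.
case: k hk => [|[|k]] // /andP[_ kn].
have dn_gt0 : 0 < dn.
  apply: arithmetical_structure_gt0 Gconn Gdr _.
  by rewrite -subn_gt0 (leq_trans _ (leq_trans kn _)) // leq_sub2l.
have dnE : dn = `|dn|%N :> int by rewrite gez0_abs // ltW.
(* The row gcd divides the diagonal entry [dn], which is positive. *)
have g_gt0 : (0 < row_gcd L ord_max)%N.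
  rewrite lt0n; apply: contraTneq dn_gt0 => g0.
  have : (row_gcd L ord_max %| `|L ord_max ord_max|)%N.
    exact: (biggcdn_inf ord_max).
  by rewrite g0 dvd0n laplacian_pivot absz_eq0 => /eqP; rewrite -/dn => ->.
have [A [DA PA AP]] := KR_minors_gcd G dn_gt0 k.+1.
have [B [DB QB BQ]] := KR_minors_gcd G dn_gt0 k.
have BA : (`|dn| ^ k * B %| `|dn| ^ k * `|dn| * A)%N.
  by rewrite -expnSr -DB -DA minors_gcd_dvdS.
have g2_gt0 : (0 < row_gcd L ord_max ^ 2)%N by rewrite expn_gt0 g_gt0.
have dnk_gt0 : (0 < `|dn| ^ k)%N by rewrite expn_gt0 absz_gt0 gt_eqF.
have [a [b [ag bg]]] :=
  ratio_comparison dnk_gt0 (minors_gcd_dvdS L k.+2) BA PA AP QB BQ.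
rewrite -expnSr -DA -DB -/L' => abE.
have {}abE : (b * invariant_factor L' k.+2 =
              `|dn| * a * invariant_factor L k.+3)%N by exact: abE.
have g2E : g ^+ 2 = (row_gcd L ord_max ^ 2)%N :> int by rewrite -[RHS]natz natrX natz.
have dvd1 : (invariant_factor L' k.+2 %|
    row_gcd L ord_max ^ 2 * `|dn| * invariant_factor L k.+3)%N.
  apply: (@dvdn_trans (b * invariant_factor L' k.+2)); first exact: dvdn_mull.
  by rewrite abE [(row_gcd _ _ ^ 2 * _)%N]mulnC dvdn_mul // dvdn_mul.
have dvd2 : (`|dn| * invariant_factor L k.+3 %|
    row_gcd L ord_max ^ 2 * invariant_factor L' k.+2)%N.
  apply: (@dvdn_trans (b * invariant_factor L' k.+2)); last exact: dvdn_mul.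
  by rewrite abE mulnAC dvdn_mulr.
have a_gt0 := dvdn_gt0 g2_gt0 ag; have b_gt0 := dvdn_gt0 g2_gt0 bg.
rewrite /alpha /alpha' g2E dnE -!PoszM !dvdzE !absz_nat; split=> //.
(* Both bounds are read off [abE], with [a] and [b] between 1 and the squared row gcd. *)
rewrite -!pmulrn ler_pdivrMr ?ltr0n // -natrM !ler_nat; split.
  apply: (@leq_trans (b * invariant_factor L' k.+2)).
    by rewrite abE leq_mul // leq_pmulr.
  by rewrite mulnC leq_mul // dvdn_leq.
apply: (@leq_trans (b * invariant_factor L' k.+2)); first by rewrite leq_pmull.
by rewrite abE [(row_gcd _ _ ^ 2 * _)%N]mulnC !leq_mul // dvdn_leq.
Qed.
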